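(* Let $r\geq 2$, let $p_1<p_2<\cdots<p_r$ be primes and $n_1,\ldots,n_r$ positive integers. Let $G$ be a finite non-cyclic nilpotent group of order $n=p_1^{n_1}p_2^{n_2}\cdots p_r^{n_r}$. For $1\leq i\leq r$, let $P_i$ be the Sylow $p_i$-subgroup of $G$. Suppose that each Sylow subgroup of $G$ is cyclic except $P_k$ for some $k\in\{1,2,\ldots,r\}$, and that $P_k$ is not a generalized quaternion $2$-group if $(k,p_1)=(1,2)$. Set $Q=P_1\cdots P_{k-1}P_{k+1}\cdots P_r$. If $p_k\geq r+1$ or if $2\phi(p_1\cdots p_{r-1})>p_1\cdots p_{r-1}$, then $Q$ is the only minimum cut-set of $\mathcal{P}(G)$, and hence $\kappa(\mathcal{P}(G))=n/p_k^{n_k}$.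
   Context: The power graph $\mathcal{P}(G)$ of a group $G$ is the simple graph with vertex set $G$ in which two distinct vertices $x,y$ are adjacent iff $x\in\langle y\rangle$ or $y\in\langle x\rangle$. A cut-set of a simple graph $\Gamma$ with vertex set $V$ is a subset $X\subseteq V$ such that the induced subgraph on $V\setminus X$ is disconnected (i.e. $V\setminus X$ is the disjoint union of two non-empty sets with no edge between them). A minimum cut-set is a cut-set $X$ with $|X|\leq|Y|$ for every cut-set $Y$. The vertex connectivity $\kappa(\Gamma)$ is the minimum number of vertices whose removal leaves a graph that is disconnected or has only one vertex. $\phi$ is Euler's totient function. *)

(* Defs.v *)
From mathcomp Require Import all_boot all_fingroup all_solvable.

Set Implicit Arguments.
Unset Strict Implicit.
Unset Printing Implicit Defensive.

(* A finite simple graph is given by a vertex set V : {set T} and an adjacency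
   relation e : rel T, of which only the values on V matter.  In [edisconnected]
   the set W is the vertex set of an induced subgraph. *)
Section Graphs.

Variables (T : finType) (e : rel T).
Implicit Types V W X Y : {set T}.

Definition edisconnected W : bool :=
  [exists A : {set T}, exists B : {set T},
    [&& A != set0, B != set0, [disjoint A & B], A :|: B == W
      & [forall x in A, forall y in B, ~~ e x y]]].

Definition cutset V X : bool := (X \subset V) && edisconnected (V :\: X).

Definition min_cutset V X : Prop :=
  cutset V X /\ forall Y, cutset V Y -> #|X| <= #|Y|.

(* The default value #|V| of the minimum is never smaller than a #|X| with
   X \subset V, so it only matters for the graph without vertices. *)
Definition vertex_connectivity V : nat :=
  \big[minn/#|V|]_(X : {set T} | (X \subset V)
       && (edisconnected (V :\: X) || (#|V :\: X| == 1))) #|X|.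

End Graphs.

Definition power_adj (gT : finGroupType) : rel gT :=
  fun x y => (x != y) && ((x \in <[y]>%g) || (y \in <[x]>%g)).

(* Main.v *)
Require Import Defs.
From mathcomp Require Import all_boot all_order all_fingroup all_solvable.

(** Write p for p_k, P for P_k and m for |Q|, so that G = P x Q with Q cyclic of
    order m prime to p.

    Removing Q disconnects the power graph: a vertex outside Q has order
    divisible by p, so the cyclic group it generates contains exactly one
    subgroup of order p, and adjacent vertices outside Q determine the same one.
    As P is a noncyclic group of odd order, it has at least two subgroups of
    order p, so the vertices outside Q fall into two nonempty parts with no edge
    between them ([complement_cutset]).

    Conversely, let X be a cut-set with at most m elements. The identity is
    adjacent to every other vertex, so it lies in X. Every g in G lies in a
    cyclic group N = M x Q with M a nontrivial cyclic subgroup of P, and N has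
    phi(|M|) phi(m) >= (p - 1) phi(m) generators. If m <= (p - 1) phi(m), then
    the at most m - 1 nontrivial elements of X cannot exhaust these generators,
    so some generator h of N survives; it is adjacent to g and to all of Q. If
    an element c of Q survived as well, every surviving g would be joined to c
    through such an h, and the graph would be connected. Hence Q is contained in
    X, and X = Q by cardinality ([small_cutset_eq_complement]).

    The arithmetic condition yields both p > 2 and m <= (p - 1) phi(m)
    ([prod_incr_primes_leq]), because m / phi(m) is the product of the
    q / (q - 1) over the primes q dividing m. There are r - 1 such primes, and
    the j-th smallest of them is at least j + 1, so this product is at most
    2/1 * 3/2 * ... * r/(r-1) = r, which settles the case p >= r + 1. In the
    other case the product over the r - 1 smallest primes is less than 2; passing
    to the primes other than p replaces p, unless it is the largest prime, by a
    larger one, which decreases the product, and p = 2 is impossible since 2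
    alone already contributes the factor 2. *)

(** * Totients of products *)

Lemma totient_prod (I : finType) (P : pred I) (F : I -> nat) :
    (forall i j, P i -> P j -> i != j -> coprime (F i) (F j)) ->
  totient (\prod_(i | P i) F i) = \prod_(i | P i) totient (F i).
Proof.
move=> coF; rewrite -![\prod_(i | P i) _]big_filter.
have: all P [seq i <- index_enum I | P i] by apply: filter_all.
have: uniq [seq i <- index_enum I | P i] by rewrite filter_uniq ?index_enum_uniq.
elim: [seq i <- _ | _] => [|i s IHs]; first by rewrite !big_nil.
case/andP=> s'i Us /andP[Pi Ps]; rewrite !big_cons totient_coprime ?IHs //.
rewrite big_seq; apply: (big_ind (coprime (F i))) => [|m1 m2 co1 co2|j sj].
- exact: coprimen1.
- by rewrite coprimeMr co1.
by apply: coF => //; [apply: (allP Ps) | apply: contraNneq s'i => ->].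
Qed.

(** This is the identity m / phi(m) = \prod q / (q - 1), with denominators
    cleared so that it can be used in [nat]. *)
Lemma totient_prod_primepow (I : finType) (P : pred I) (p n : I -> nat) :
    injective p -> (forall i, prime (p i)) -> (forall i, 0 < n i) ->
  (\prod_(i | P i) p i ^ n i) * \prod_(i | P i) (p i).-1
    = totient (\prod_(i | P i) p i ^ n i) * \prod_(i | P i) p i.
Proof.
move=> p_inj p_pr n_gt0; rewrite totient_prod => [|i j _ _ neq_ij]; last first.
  rewrite coprimeXl ?coprimeXr // prime_coprime // dvdn_prime2 //.
  by rewrite (inj_eq p_inj).
rewrite -!big_split /=; apply: eq_bigr => i _.
by rewrite totient_pfactor // mulnC -mulnA -expnSr prednK.
Qed.

(** The product of the q / (q - 1) is largest when s = 2, 3, ..., where it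
    telescopes to (size s).+1. The bound 1 < q on the entries of s is the
    starting point of the path. *)
Lemma prod_leq_size_prod_pred (s : seq nat) :
  path ltn 1 s -> \prod_(q <- s) q <= (size s).+1 * \prod_(q <- s) q.-1.
Proof.
have size_lt_last t: path ltn 1 t -> size t < last 1 t.
  elim/last_ind: t => // t q IHt; rewrite rcons_path last_rcons size_rcons.
  by case/andP=> /IHt; apply: leq_ltn_trans.
elim/last_ind: s => [|s q IHs] s_inc; first by rewrite !big_nil.
have := size_lt_last _ s_inc; rewrite last_rcons !size_rcons => lt_s_q.
move: s_inc; rewrite rcons_path => /andP[s_inc _].
rewrite -cats1 !big_cat !big_seq1 /= mulnA.
(* What is left to compare is (size s).+1 * q with (size s).+2 * q.-1, that is,
   (size s).+2 with q. *)
apply: (@leq_trans ((size s).+1 * \prod_(i <- s) i.-1 * q)).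
  by rewrite leq_mul2r IHs ?orbT.
rewrite mulnAC [leqRHS]mulnAC leq_mul2r; apply/orP; right.
case: q lt_s_q => // q; rewrite ltnS => lt_s_q /=.
by rewrite mulnS [leqRHS]mulSn leq_add2r.
Qed.

(** * Connectedness through a hub *)

(** A vertex that every other vertex reaches in at most two steps is a handy
    certificate of connectedness: it makes any two sides of a separation meet. *)
Lemma edisconnected_hub (T : finType) (e : rel T) (W : {set T}) (c : T) :
    symmetric e -> c \in W ->
    (forall w, w \in W ->
       exists2 h, h \in W & ((w == h) || e w h) && ((h == c) || e h c)) ->
  ~~ edisconnected e W.
Proof.
move=> e_sym Wc hubP; apply/existsP=> -[A /existsP[B]].
case/and5P=> A0 B0 dAB /eqP defW /forall_inP neAB.
have closedP w h: w \in W -> h \in W -> (w == h) || e w h -> (w \in A) = (h \in A).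
  have inB v: v \in W -> v \notin A -> v \in B.
    by rewrite -defW inE => /orP[-> | ].
  move=> Ww Wh /predU1P[-> // | e_wh]; apply/idP/idP => [Aw | Ah].
    apply: contraLR e_wh => /(inB _ Wh) Bh.
    by apply: (forall_inP (neAB w Aw)).
  apply: contraLR e_wh => /(inB _ Ww) Bw; rewrite e_sym.
  by apply: (forall_inP (neAB h Ah)).
have sAc w: w \in W -> (w \in A) = (c \in A).
  move=> Ww; have [h Wh /andP[wh hc]] := hubP w Ww.
  by rewrite (closedP w h) ?(closedP h c).
case/set0Pn: A0 => a Aa; case/set0Pn: B0 => b Bb.
have /negP[] := disjointFl dAB Bb.
by rewrite sAc -?(sAc a) -?defW ?inE ?Aa ?Bb ?orbT.
Qed.

(** * Cut-sets of the power graph of a p-group times a cyclic group *)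

(** A noncyclic p-group of odd order has p-rank at least 2, and a subgroup of
    order p cannot fill an elementary abelian group of order p ^ 2. *)
Lemma odd_pgroup_two_subgroups (gT : finGroupType) (P : {group gT}) (p : nat) :
    prime p -> odd p -> (p.-group P)%g -> ~~ cyclic P ->
  exists s t, [/\ s \in P, t \in P, #[s]%g = p, #[t]%g = p & s \notin <[t]>%g].
Proof.
move=> p_pr p_odd pP; rewrite (odd_pgroup_rank1_cyclic pP); last first.
  exact: odd_pgroup_odd pP.
rewrite -ltnNge => /p_rank_geP[E /pnElemP[sEP abelE logE]].
have oE: #|E| = p ^ 2 by rewrite (card_pgroup (abelem_pgroup abelE)) logE.
have proper_line t: #[t]%g = p -> exists2 s, s \in E & s \notin <[t]>%g.
  move=> ot; apply/subsetPn; apply: contraTN (prime_gt1 p_pr) => /subset_leq_card.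
  by rewrite oE -orderE ot -leqNgt -{2}[p]muln1 leq_pmul2l ?prime_gt0.
have nt v (A : {group gT}) : v \notin A -> v != 1%g by apply: contraNneq => ->.
have [t Et]: exists2 t, t \in E & t != 1%g.
  apply/trivgPn; apply: contra_eq_neq oE => ->.
  by rewrite cards1 eq_sym -(exp1n 2) eqn_exp2r // gtn_eqF ?prime_gt1.
move/(abelem_order_p abelE Et) => ot; have [s Es s't] := proper_line t ot.
exists s, t; split; rewrite ?(subsetP sEP) //.
by apply: (abelem_order_p abelE) (nt _ _ s't).
Qed.

Lemma power_adj_sym (gT : finGroupType) : symmetric (@power_adj gT).
Proof. by move=> x y; rewrite /power_adj eq_sym orbC. Qed.

Lemma cycle_power_adj (gT : finGroupType) (x y : gT) :
  x \in <[y]>%g -> (x == y) || power_adj x y.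
Proof. by rewrite /power_adj => ->; rewrite andbT orbN. Qed.

Section DirectProductWithCyclic.

Variables (gT : finGroupType) (G P C : {group gT}) (p : nat).
Hypotheses (p_pr : prime p) (pP : (p.-group P)%g) (p'C : (p^'.-group C)%g).
Hypothesis (defG : (P \x C)%g = G).

Lemma mem_complement_p'elt g : g \in G -> (g \in C) = (p^'.-elt g)%g.
Proof.
have [_ nsCG] := dprod_normal2 defG; apply: mem_normal_Hall => //.
rewrite /pHall normal_sub // p'C -divgS ?normal_sub // -(dprod_card defG).
by rewrite mulnK ?cardG_gt0 // pnatNK.
Qed.

(** The vertices outside C are split according to whether the unique subgroup of
    order p of the cyclic group they generate is <[s]>. *)
Lemma complement_cutset :
    (exists s t,
       [/\ s \in P, t \in P, #[s]%g = p, #[t]%g = p & s \notin <[t]>%g]) ->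
  cutset (@power_adj gT) G C.
Proof.
case=> s [t [Ps Pt os ot s't]].
have [/andP[sPG _] /andP[sCG _]] := dprod_normal2 defG.
have notC v: v \in P -> #[v]%g = p -> v \notin C.
  move=> Pv ov; rewrite mem_complement_p'elt ?(subsetP sPG) // /p_elt ov.
  by rewrite pnatE // !inE eqxx.
rewrite /cutset sCG; apply/existsP; exists [set g in G :\: C | s \in <[g]>%g].
apply/existsP; exists [set g in G :\: C | s \notin <[g]>%g].
apply/and5P; split.
- by apply/set0Pn; exists s; rewrite !inE notC // (subsetP sPG) ?cycle_id.
- by apply/set0Pn; exists t; rewrite !inE notC // (subsetP sPG).
- by apply/pred0P=> g /=; rewrite !inE; case: (s \in _); rewrite ?andbF.
- by apply/eqP/setP=> g; rewrite !inE -andb_orr orbN andbT.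
apply/forall_inP=> g; rewrite !inE => /andP[/andP[C'g Gg] gs].
apply/forall_inP=> h; rewrite !inE => /andP[/andP[C'h Gh]].
(* If h lies in <[g]>, then <[h]> has order divisible by p, hence contains the
   only subgroup of order p of the cyclic group <[g]>, which is <[s]>. *)
apply: contra; rewrite /power_adj => /andP[_ /orP[gh | hg]].
  by apply: subsetP gs; rewrite cycle_subG.
rewrite -cycle_subG -(cardSg_cyclic (cycle_cyclic g)) ?cycle_subG //.
rewrite -!orderE os; apply: contraR C'h => p'h.
by rewrite mem_complement_p'elt // /p_elt p'natE.
Qed.

Hypotheses (cycC : cyclic C) (ntP : P :!=: 1%g).

(** The generator h is x' * c, where c generates C and x' is a nontrivial element
    of P whose cycle contains the P-component of g; x' has to be chosen
    nontrivial even when g lies in C, as this provides the factor p.-1. *)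
Lemma cyclic_over_complement g : g \in G ->
  exists h, [/\ h \in G, h != 1%g, g \in <[h]>%g, C \subset <[h]>%g
              & p.-1 * totient #|C| <= totient #[h]%g].
Proof.
move=> Gg; have [x [y [Px Cy -> _]]] := mem_dprod defG Gg.
have [x' [Px' nt_x' xx']]: exists x', [/\ x' \in P, x' != 1%g & x \in <[x']>%g].
  have [-> | nt_x] := eqVneq x 1%g; last by exists x; rewrite cycle_id.
  by have /trivgPn[x' Px' ntx'] := ntP; exists x'; rewrite group1.
have [c defC] := cyclicP cycC; have Cc: c \in C by rewrite defC cycle_id.
have [_ defPC cPC _] := dprodP defG.
have cxc: commute x' c by apply: commute_sym; apply: (centsP cPC).
have coxc: coprime #[x']%g #[c]%g.
  exact: pnat_coprime (mem_p_elt pP Px') (mem_p_elt p'C Cc).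
have defh := cycleM cxc coxc.
exists (x' * c)%g; split.
- by rewrite -defPC mem_mulg.
- apply: contraNneq nt_x' => xc1; rewrite -cycle_eq1 -subG1.
  by rewrite -(cycle1 gT) -xc1 defh mulG_subl.
- by rewrite defh mem_mulg // -defC.
- by rewrite defh defC mulG_subr.
rewrite orderM // totient_coprime // defC -orderE leq_mul2r; apply/orP; right.
have [n ox'] := p_natP (mem_p_elt pP Px'); rewrite ox'.
case: n ox' => [/eqP | n _]; first by rewrite order_eq1 (negPf nt_x').
by rewrite totient_pfactor // leq_pmulr // expn_gt0 prime_gt0.
Qed.

(** If X missed an element c of C, then c would be a hub of the remaining graph:
    every remaining w is joined to c by a remaining generator of a cyclic group
    containing w and C. *)
Lemma small_cutset_eq_complement (X : {set gT}) :
    #|C| <= p.-1 * totient #|C| ->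
  cutset (@power_adj gT) G X -> #|X| <= #|C| -> X = C.
Proof.
move=> leC /andP[sXG]; have e_sym := @power_adj_sym gT.
have [_ /andP[sCG _]] := dprod_normal2 defG.
move=> cutX leXC.
(* Otherwise the identity, adjacent to all other vertices, is a hub. *)
have X1: 1%g \in X.
  apply: contraLR cutX => X'1; apply: (@edisconnected_hub _ _ _ 1%g) => //.
    by rewrite inE X'1 group1.
  move=> w Ww; exists 1%g; first by rewrite inE X'1 group1.
  rewrite eqxx andbT eq_sym e_sym; apply: cycle_power_adj; exact: group1.
apply/eqP; rewrite eq_sym eqEcard leXC andbT.
apply: contraLR cutX => /subsetPn[c Cc X'c].
apply: (@edisconnected_hub _ _ _ c) => //.
  by rewrite inE X'c (subsetP sCG).
move=> w /setDP[Gw X'w].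
have [h [Gh nt_h wh sCh leh]] := cyclic_over_complement _ Gw.
(* A generator h' of <[h]> survives by counting: X contains the identity, which
   does not generate <[h]>, so X has too few other elements. *)
have /subsetPn[h' gen_h' X1'h']:
    ~~ ([set x | generator <[h]>%g x] \subset X :\ 1%g).
  apply: contraTN leXC => /subset_leq_card; rewrite -totient_gen => leX.
  rewrite (cardsD1 1%g X) X1 add1n -ltnNge ltnS.
  exact: leq_trans leC (leq_trans leh leX).
move: gen_h'; rewrite inE /generator => /eqP eq_h.
have nt_h': h' != 1%g by rewrite -cycle_eq1 -eq_h cycle_eq1.
exists h'.
  rewrite inE; move: X1'h'; rewrite !inE nt_h' /= => ->.
  by rewrite -cycle_subG -eq_h cycle_subG.
rewrite [h' == c]eq_sym [_ h' c]e_sym !cycle_power_adj -?eq_h //.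
exact: subsetP sCh c Cc.
Qed.

Lemma complement_only_min_cutset :
    (exists s t,
       [/\ s \in P, t \in P, #[s]%g = p, #[t]%g = p & s \notin <[t]>%g]) ->
    #|C| <= p.-1 * totient #|C| ->
  min_cutset (@power_adj gT) G C
    /\ forall X : {set gT}, min_cutset (@power_adj gT) G X -> X = C.
Proof.
move=> /complement_cutset cutC leC; split=> [|X [cutX minX]]; last first.
  by apply: small_cutset_eq_complement => //; apply: minX.
split=> // Y cutY; case: (leqP #|Y| #|C|) => [leYC | /ltnW //].
by rewrite (small_cutset_eq_complement _ leC cutY leYC).
Qed.

End DirectProductWithCyclic.

(** * Vertex connectivity *)

(** Leaving a single vertex means removing all the others, which is no cheaper
    than removing a proper subset X of V. *)
Lemma min_cutset_vertex_connectivity (T : finType) (e : rel T) (V X : {set T}) :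
  min_cutset e V X -> #|X| < #|V| -> vertex_connectivity e V = #|X|.
Proof.
case=> /andP[sXV dX] minX ltXV; rewrite /vertex_connectivity.
apply/eqP; rewrite eqn_leq; apply/andP; split.
  rewrite -leEnat -minEnat; apply: Order.TotalTheory.bigmin_le_cond.
  by rewrite sXV dX.
apply: (big_ind (leq #|X|)) => [|m n leXm leXn|Y /andP[sYV]].
- exact: ltnW.
- by rewrite leq_min leXm.
case/orP=> [dY | /eqP V_Y]; first by apply: minX; rewrite /cutset sYV.
move: ltXV; rewrite -(cardsID Y V) V_Y addn1 ltnS => leXY.
by apply: leq_trans leXY (subset_leq_card (subsetIr V Y)).
Qed.

(** * The arithmetic condition *)

(** The factor a / a.-1 decreases when a grows to b, so the upper bound 2 is
    inherited. *)
Lemma leq_pred_ratio (a b R S : nat) :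
  1 < a <= b -> a * R <= 2 * (a.-1 * S) -> b * R <= 2 * (b.-1 * S).
Proof.
case/andP=> a_gt1 leab leRS; rewrite -(@leq_pmul2l a.-1) -?subn1 ?subn_gt0 // !subn1.
apply: (@leq_trans (b.-1 * (a * R))).
  rewrite !mulnA leq_mul2r; apply/orP; right.
  by rewrite -!subn1 !mulnBl !mul1n [b * a]mulnC leq_sub2l.
by rewrite [leqRHS]mulnCA [a.-1 * (_ * S)]mulnCA [leqRHS]mulnCA leq_mul2l leRS orbT.
Qed.

Section IncreasingPrimes.

Variables (r : nat) (p : 'I_r -> nat) (k : 'I_r).
Hypotheses (p_prime : forall i, prime (p i)).
Hypothesis (p_incr : forall i j : 'I_r, i < j -> p i < p j).

Lemma incr_ord_inj : injective p.
Proof.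
move=> i j; case: (ltngtP i j) => [/p_incr | /p_incr | /val_inj //].
  by move=> lt_p eq_p; rewrite eq_p ltnn in lt_p.
by move=> lt_p eq_p; rewrite eq_p ltnn in lt_p.
Qed.

Lemma leq_prod_incr_primes_but_one :
  \prod_(i | i != k) p i <= r * \prod_(i | i != k) (p i).-1.
Proof.
pose e := [seq i <- enum 'I_r | i != k].
have sze: (size e).+1 = r.
  rewrite size_filter -/(predC1 k) -[RHS]card_ord (cardD1 k) inE add1n; congr _.+1.
  by rewrite cardE size_filter enumT; apply: eq_count => i; rewrite !inE andbT.
have prod_e F : \prod_(i | i != k) F (p i) = \prod_(q <- map p e) F q.
  by rewrite big_map big_filter big_enum_cond.
rewrite (prod_e id) (prod_e predn).
have := @prod_leq_size_prod_pred (map p e); rewrite size_map sze; apply.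
rewrite (path_sortedE ltn_trans) all_map.
apply/andP; split; first by apply/allP=> i _; apply: prime_gt1.
rewrite sorted_map.
apply: (@sub_sorted _ (relpre val ltn)) => [i j /p_incr // |].
apply: sorted_filter => [i j l|]; first exact: ltn_trans.
by rewrite -sorted_map val_enum_ord iota_ltn_sorted.
Qed.

Lemma prod_incr_primes_leq :
    1 < r ->
    r.+1 <= p k \/
      \prod_(i < r | i.+1 < r) p i < 2 * totient (\prod_(i < r | i.+1 < r) p i) ->
  2 < p k /\
    \prod_(i | i != k) p i <= (p k).-1 * \prod_(i | i != k) (p i).-1.
Proof.
have pgt0 i : 0 < p i by apply: prime_gt0.
move=> r_gt1 [lt_r_pk | ].
  split; first exact: leq_trans lt_r_pk.
  apply: leq_trans leq_prod_incr_primes_but_one _.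
  by rewrite leq_mul2r -ltnS prednK ?lt_r_pk ?orbT.
have r_gt0: 0 < r by apply: ltnW.
have lt_last: r.-1 < r by rewrite prednK.
pose l := Ordinal lt_last.
have le_last (i : 'I_r) : i <= l by rewrite -ltnS [l.+1](prednK r_gt0) ltn_ord.
have eq_last (i : 'I_r) : (i.+1 < r) = (i != l).
  by rewrite -(inj_eq val_inj) -eqSS /= (prednK r_gt0) ltn_neqAle ltn_ord andbT.
rewrite totient_prod => [|i j _ _ neq_ij]; last first.
  by rewrite prime_coprime // dvdn_prime2 // (inj_eq incr_ord_inj).
under [in X in _ < X]eq_bigr do rewrite totient_prime //.
rewrite !(eq_bigl _ _ eq_last) => ltM.
have [-> | neq_kl] := eqVneq k l.
  have pl_gt2: 2 < p l.
    apply: leq_ltn_trans (p_incr (Ordinal r_gt0) l _); first exact: prime_gt1.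
    by rewrite /= -ltnS prednK.
  split=> //; apply: leq_trans (ltnW ltM) _.
  by rewrite leq_mul2r -ltnS prednK ?pl_gt2 ?orbT.
(* The two products now differ only in that p k is replaced by p l >= p k. *)
rewrite !(bigD1 k neq_kl) /= in ltM.
rewrite eq_sym in neq_kl; rewrite !(bigD1 l neq_kl) /=.
rewrite !(eq_bigl _ _ (fun i => andbC (i != k) (i != l))).
have leR: \prod_(i | (i != l) && (i != k)) (p i).-1
            <= \prod_(i | (i != l) && (i != k)) p i.
  by apply: leq_prod => i _; apply: leq_pred.
(* If p k = 2, the factor p k / (p k).-1 is already 2, and the others are at
   least 1. *)
have pk_gt2: 2 < p k.
  rewrite ltn_neqAle prime_gt1 // andbT; apply: contraTneq ltM => <-.
  by rewrite mul1n -leqNgt leq_mul2l leR.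
have le_pkl: p k <= p l.
  by apply: ltnW; apply: p_incr; rewrite ltn_neqAle le_last andbT eq_sym.
split=> //; apply: leq_trans (leq_pred_ratio _ _ _ _ _ (ltnW ltM)) _.
  by rewrite le_pkl prime_gt1.
by rewrite leq_mul2r -ltnS prednK ?pk_gt2 ?orbT.
Qed.

End IncreasingPrimes.

(** * Products of normal subgroups *)

(** The set Q of the theorem is only a setwise product of subgroups; normality of
    the factors is what turns it into a group. *)
Lemma normal_pgroup_prod (I : finType) (Q : pred I) (gT : finGroupType)
    (G : {group gT}) (A : I -> {group gT}) (pi : nat_pred) :
    (forall i, Q i -> A i <| G)%g -> (forall i, Q i -> pi.-group (A i))%g ->
  exists K : {group gT},
    [/\ (\prod_(i | Q i) A i)%g = K, (K <| G)%g, (pi.-group K)%g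
      & forall i, Q i -> A i \subset K].
Proof.
move=> nAG piA.
have [K [defK nKG piK]]: exists K : {group gT},
    [/\ (\prod_(i | Q i) A i)%g = K, (K <| G)%g & (pi.-group K)%g].
  apply: (big_ind (fun B : {set gT} => exists K : {group gT},
            [/\ B = K, (K <| G)%g & (pi.-group K)%g])) => [|B1 B2|i Qi].
  - by exists 1%G; rewrite normal1 pgroup1.
  - case=> K1 [-> nK1 piK1] [K2 [-> nK2 piK2]]; exists (K1 <*> K2)%G.
    have defK: (K1 <*> K2)%g = (K1 * K2)%g.
      by rewrite norm_joinEl // (subset_trans (normal_sub nK1)) ?normal_norm.
    by rewrite normalY //= defK pgroupM piK1.
  by exists (A i); rewrite nAG ?piA.
exists K; split=> // j Qj; apply/subsetP=> x Ax; rewrite -defK.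
(* x is the product of the family that is x at j and 1 elsewhere. *)
have <-: (\prod_(i | Q i) if i == j then x else 1)%g = x.
  by rewrite -big_mkcondr (big_pred1 j) // => i; rewrite andbC /=; case: eqP => //= ->.
by apply: mem_prodg => i _; case: eqP => [-> // | _]; apply: group1.
Qed.

(** * The minimum cut-set *)

Theorem theorem1p2 (r : nat) (p n : 'I_r -> nat) (gT : finGroupType)
    (G : {group gT}) (P : 'I_r -> {group gT}) (k : 'I_r)
    (r_ge2 : 2 <= r)
    (p_prime : forall i : 'I_r, prime (p i))
    (p_incr : forall i j : 'I_r, i < j -> p i < p j)
    (n_pos : forall i : 'I_r, 0 < n i)
    (G_noncyclic : ~~ cyclic G)
    (G_nilpotent : nilpotent G)
    (G_order : #|G| = \prod_(i < r) p i ^ n i)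
    (P_Sylow : forall i : 'I_r, ((p i).-Sylow(G) (P i))%g)
    (P_cyclic : forall i : 'I_r, i != k -> cyclic (P i))
    (Pk_noncyclic : ~~ cyclic (P k))
    (* the first prime has index 0 *)
    (Pk_not_quaternion : nat_of_ord k = 0 -> p k = 2 ->
       ~ exists m : nat, 3 <= m /\ (P k \isog 'Q_(2 ^ m)%N)%g)
    (p_large : r.+1 <= p k \/
       \prod_(i < r | i.+1 < r) p i
         < 2 * totient (\prod_(i < r | i.+1 < r) p i)) :
  let Q : {set gT} := (\prod_(i < r | i != k) P i)%g in
  (min_cutset (@power_adj gT) G Q
   /\ forall X : {set gT}, min_cutset (@power_adj gT) G X -> X = Q)
  /\ vertex_connectivity (@power_adj gT) G = #|G| %/ p k ^ n k.
Proof.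
have p_inj := incr_ord_inj _ _ p_incr.
have [pk_gt2 le_prod] := prod_incr_primes_leq _ _ k p_prime p_incr r_ge2 p_large.
have nP i : (P i <| G)%g.
  by rewrite (nilpotent_Hall_pcore G_nilpotent (P_Sylow i)) pcore_normal.
have p'P i : i != k -> ((p k)^'.-group (P i))%g.
  move=> neq_ik; apply: sub_pgroup (pHall_pgroup (P_Sylow i)) => q.
  by rewrite !inE => /eqP->; rewrite (inj_eq p_inj).
have [C [-> nC p'C sPC]] := normal_pgroup_prod _ _ _ _ _ _ (fun i _ => nP i) p'P.
have prime_div q : prime q -> q %| #|G| -> exists i, q = p i.
  move=> q_pr; rewrite G_order Euclid_dvd_prod // big_has_cond.
  case/hasP=> i _ /= ; rewrite Euclid_dvdX // => /andP[]; rewrite dvdn_prime2 //.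
  by move/eqP; exists i.
(* A prime p i with i != k does not divide the index of C, because C contains the
   Sylow subgroup P i. *)
have pkG : (p k).-nat #|G : C|%g.
  apply/pnatP=> [|q q_pr q_dv]; first exact: indexg_gt0.
  have [i def_q] := prime_div q q_pr (dvdn_trans q_dv (dvdn_indexg G C)).
  rewrite inE /= def_q (inj_eq p_inj); apply: contraTT q_dv => neq_ik.
  rewrite def_q -p'natE //; have [_ _] := and3P (P_Sylow i); apply: pnat_dvd.
  by rewrite -(Lagrange_index (normal_sub nC) (sPC i neq_ik)) dvdn_mulr.
have hallC : ((p k)^'.-Hall(G) C)%g.
  by rewrite /pHall normal_sub // p'C pnatNK.
(* C is nilpotent with cyclic Sylow subgroups. *)
have cycC : cyclic C.
  apply: nil_Zgroup_cyclic (nilpotentS (normal_sub nC) G_nilpotent).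
  apply/forall_inP=> V /SylowP[q q_pr sylV].
  have [sVC qV _] := and3P sylV.
  have [/eqP-> | ntV] := boolP (V == 1%G); first exact: cyclic1.
  have [_ q_dv _] := pgroup_pdiv qV ntV.
  have q_dvC := dvdn_trans q_dv (cardSg sVC).
  have q_dvG := dvdn_trans q_dvC (cardSg (normal_sub nC)).
  have [i def_q] := prime_div q q_pr q_dvG.
  have neq_ik : i != k.
    apply: contraTneq (pnatP _ (cardG_gt0 C) p'C q q_pr q_dvC) => eq_ik.
    by rewrite def_q eq_ik !inE eqxx.
  apply: cyclicS (P_cyclic i neq_ik).
  by rewrite (sub_normal_Hall (P_Sylow i)) ?(subset_trans sVC) ?normal_sub // -def_q.
have defG : (P k \x C)%g = G.
  rewrite (nilpotent_Hall_pcore G_nilpotent (P_Sylow k)).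
  by rewrite (nilpotent_Hall_pcore G_nilpotent hallC) nilpotent_pcoreC.
have p'm : (p k)^'.-nat (\prod_(i < r | i != k) p i ^ n i).
  apply: (big_ind (fun m => (p k)^'.-nat m)) => // [a b|i neq_ik].
    by rewrite pnatM => ->.
  by rewrite pnatX pnatE // !inE (inj_eq p_inj) neq_ik.
have pkn_gt0 : 0 < p k ^ n k by rewrite expn_gt0 prime_gt0.
have /andP[m_gt0 _] := p'm.
have oC : #|C| = \prod_(i < r | i != k) p i ^ n i.
  rewrite (card_Hall hallC) G_order (bigD1 k) //= (partnM _ pkn_gt0 m_gt0).
  by rewrite part_p'nat ?mul1n ?part_pnat_id // pnatNK pnatX pnat_id.
have lt_CG : #|C| < #|G|.
  rewrite -(dprod_card defG) ltn_Pmull ?cardG_gt0 // cardG_gt1.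
  by apply: contraNneq Pk_noncyclic => ->; apply: cyclic1.
have leC : #|C| <= (p k).-1 * totient #|C|.
  have pred_gt0: 0 < \prod_(i | i != k) (p i).-1.
    by apply: prodn_gt0 => i; rewrite -subn1 subn_gt0 prime_gt1.
  rewrite -(leq_pmul2r pred_gt0) oC totient_prod_primepow //.
  by rewrite [leqRHS]mulnAC mulnC leq_mul2r le_prod orbT.
have pkP := pHall_pgroup (P_Sylow k).
have ntP : P k :!=: 1%g by apply: contraNneq Pk_noncyclic => ->; apply: cyclic1.
have oddp : odd (p k) by case: (even_prime (p_prime k)) pk_gt2 => // ->.
have two := odd_pgroup_two_subgroups _ _ _ (p_prime k) oddp pkP Pk_noncyclic.
have [minC onlyC] :=
  complement_only_min_cutset _ _ _ _ _ (p_prime k) pkP p'C defG cycC ntP two leC.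
split; first by split.
rewrite (min_cutset_vertex_connectivity _ _ _ _ minC lt_CG) oC G_order [in RHS](bigD1 k) //=.
by rewrite mulKn.
Qed.
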